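(* Let $\theta_1,\dots,\theta_r$ be real numbers, not all in $\pi\mathbb{Q}$ (non-degenerate case), with $d$, $\nu_\theta$ and the random variable $Z_\theta$ as defined in the context. Let $f\in\mathbb{C}(X_1,\dots,X_r)$ with no pole in $\mathbb{T}^r$. Then for $0\le a\le d-1$, one has $\mathbb{P}(f(\nu_\theta^aZ_\theta)=0)=0$ if and only if there exists an integer $n\equiv a\bmod d$ such that $f(e^{i\theta_1n},\dots,e^{i\theta_rn})\ne0$.
   Context: $\mathbb{T}=\{z\in\mathbb{C}:|z|=1\}$, and $\mathbb{T}^r$ is a group under coordinatewise multiplication. A rational function has no pole on $\mathbb{T}^r$ if it can be written $P/Q$ with polynomials $P,Q$ such that $Q$ does not vanish on $\mathbb{T}^r$. Let $m$ be defined by $m+1=\dim_{\mathbb{Q}}\mathrm{Span}_{\mathbb{Q}}(\pi,\theta_1,\dots,\theta_r)$ (so $m\ge1$ in the non-degenerate case). After reindexing the $\theta_i$ (and correspondingly the variables $X_i$), it is assumed that $\{2\pi,\theta_1,\dots,\theta_m\}$ is a basis of this $\mathbb{Q}$-vector space, and one writes $\theta_j=2\pi c_j+\sum_{k=1}^m b_{k,j}\theta_k$ for $m+1\le j\le r$, with $c_j,b_{k,j}\in\mathbb{Q}$. Let $d\ge1$ be the least common multiple of the denominators of all the $c_j$ and $b_{k,j}$ ($d=1$ if $m=r$), $h_{k,j}=d\,b_{k,j}\in\mathbb{Z}$, and $\nu_\theta=(e^{i\theta_1},\dots,e^{i\theta_r})$. Then $Z_\theta=\left(Z_1^d,\dots,Z_m^d,\prod_{k=1}^mZ_k^{h_{k,m+1}},\dots,\prod_{k=1}^mZ_k^{h_{k,r}}\right)$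 where $Z_1,\dots,Z_m$ are independent uniform random variables on $\mathbb{T}$. *)

(* Defs.v *)
From HB Require Import structures.
From mathcomp Require Import all_boot all_order all_algebra ring.
From mathcomp Require Import complex fraction.
From mathcomp Require Import all_classical all_reals all_analysis.
(* A full Import is avoided: the notations of mpoly clash with those of
   mathcomp-analysis. *)
From mathcomp Require mpoly.
Import (canonicals, coercions) mpoly.

Set Implicit Arguments.
Unset Strict Implicit.
Unset Printing Implicit Defensive.

Import Order.TTheory GRing.Theory Num.Theory.

Local Open Scope classical_set_scope.
Local Open Scope ring_scope.
Local Open Scope complex_scope.

Section Torus.
Variable R : realType.

Definition cis (t : R) : R[i] := cos t +i* sin t.

Definition circle : set R[i] := [set z | `|z| = 1].

Definition torus (n : nat) : set ('I_n -> R[i]) :=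
  [set x | forall k, circle (x k)].

End Torus.

Section RationalFunctions.
Variables (K : fieldType) (n : nat).

Definition ratfun := {fraction (mpoly.mpoly n K)}.

(* The value of f at x is P(x)/Q(x) for any representation f = P/Q with
   Q(x) <> 0 (see rat_evalE); if x is a pole, the junk value is 0. *)
Definition rat_eval (f : ratfun) (x : 'I_n -> K) : K :=
  xget 0 [set v | exists P Q : mpoly.mpoly n K,
    [/\ f = tofrac P / tofrac Q, mpoly.meval x Q != 0
      & v = mpoly.meval x P / mpoly.meval x Q]].

Definition no_pole_on (D : set ('I_n -> K)) (f : ratfun) : Prop :=
  exists P Q : mpoly.mpoly n K,
    f = tofrac P / tofrac Q /\
    forall x, D x -> mpoly.meval x Q != 0.

Lemma rat_evalE (P Q : mpoly.mpoly n K) (x : 'I_n -> K) :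
  mpoly.meval x Q != 0 ->
  rat_eval (tofrac P / tofrac Q) x = mpoly.meval x P / mpoly.meval x Q.
Proof.
move=> Qx; rewrite /rat_eval; case: xgetP => [v _ /= [P' [Q' [e Q'x ->]]]|].
  have nz S : mpoly.meval x S != 0 -> tofrac S != 0.
    by apply: contraNneq => /eqP; rewrite tofrac_eq0 => /eqP ->;
       rewrite mpoly.meval0.
  move/eqP: e; rewrite eqr_div ?nz// -!tofracM tofrac_eq => /eqP e.
  by apply/eqP; rewrite eqr_div// -!mpoly.mevalM e.
by move=> /(_ (mpoly.meval x P / mpoly.meval x Q))[]; exists P, Q.
Qed.

End RationalFunctions.

Section RationalSpan.
Variable R : realType.

Definition Qspan (s : seq R) : set R :=
  [set x | exists a : 'I_(size s) -> rat, x = \sum_i ratr (a i) * s`_i].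

Definition Qfree (s : seq R) : Prop :=
  forall a : 'I_(size s) -> rat,
    \sum_i ratr (a i) * s`_i = 0 -> forall i, a i = 0.

Definition Qbasis (s : seq R) (V : set R) : Prop := Qfree s /\ Qspan s = V.

End RationalSpan.

Section Exponents.
Variables (m s : nat) (c : 'I_s -> rat) (b : 'I_m -> 'I_s -> rat).

Definition common_denom : nat :=
  lcmn (\big[lcmn/1%N]_(j < s) `|denq (c j)|%N)
       (\big[lcmn/1%N]_(k < m) \big[lcmn/1%N]_(j < s) `|denq (b k j)|%N).

(* The product is an integer, so that numq loses nothing (see expoE). *)
Definition expo (k : 'I_m) (j : 'I_s) : int := numq (common_denom%:R * b k j).

Lemma expoE k j : (expo k j)%:~R = common_denom%:R * b k j.
Proof.
have /dvdnP[q e] : (`|denq (b k j)| %| common_denom)%N.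
  apply: dvdn_trans (dvdn_lcmr _ _).
  rewrite (bigD1 k)//= (bigD1 j)//=.
  exact: dvdn_trans (dvdn_lcml _ _) (dvdn_lcml _ _).
have eZ : common_denom%:R * b k j = (q%:Z * numq (b k j))%:~R.
  by rewrite e natrM intrM numqE -{2}absz_denq -mulrA; ring.
by rewrite /expo eZ numq_int.
Qed.

Lemma common_denom_gt0 : (0 < common_denom)%N.
Proof.
have lcm_gt0 (I : finType) (F : I -> nat) : (forall i, 0 < F i)%N ->
    (0 < \big[lcmn/1%N]_i F i)%N.
  by move=> F0; elim/big_ind: _ => // x y x0 y0; rewrite lcmn_gt0 x0.
rewrite /common_denom lcmn_gt0 !lcm_gt0// => [k|j].
  by apply: lcm_gt0 => j; rewrite absz_gt0 denq_neq0.
by rewrite absz_gt0 denq_neq0.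
Qed.

End Exponents.

Section CircleRandomVariables.
Context (R : realType) (disp : measure_display) (Om : measurableType disp)
  (Pr : probability Om R).

(* Borel sets of the complex plane, identified with R * R. *)
Definition Cmeasurable (A : set R[i]) : Prop :=
  measurable [set p : R * R | A (p.1 +i* p.2)].

(* Circle-valued random variables are everywhere, not just almost surely,
   circle-valued. *)
Definition circle_rv (Z : Om -> R[i]) : Prop :=
  (forall w, circle (Z w)) /\
  (forall A, Cmeasurable A -> measurable (Z @^-1` A)).

(* The uniform law on the circle is the image of the uniform law on [0, 1]
   by t |-> exp(2 pi i t). *)
Definition uniform_on_circle (Z : Om -> R[i]) : Prop :=
  forall A, Cmeasurable A ->
    Pr (Z @^-1` A) =
    uniform_prob (@ltr01 R) [set t | A (cis (2 * pi * t))].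

Definition mutually_independent (I : finType) (Z : I -> Om -> R[i]) : Prop :=
  forall (J : {set I}) (A : I -> set R[i]),
    (forall k, Cmeasurable (A k)) ->
    Pr [set w | forall k, k \in J -> A k (Z k w)] =
    (\prod_(k in J) Pr (Z k @^-1` A k))%E.

End CircleRandomVariables.

Definition Ztheta (R : realType) (Om : Type) (m s : nat)
    (c : 'I_s -> rat) (b : 'I_m -> 'I_s -> rat) (Z : 'I_m -> Om -> R[i])
    (w : Om) (i : 'I_(m + s)) : R[i] :=
  match fintype.split i with
  | inl k => Z k w ^+ common_denom c b
  | inr j => \prod_(k < m) Z k w ^ expo c b k j
  end.

(* Main.v *)
Require Import Defs.
From HB Require Import structures.
From mathcomp Require Import all_boot all_order all_algebra.
From mathcomp Require Import complex fraction.
From mathcomp Require Import all_classical all_reals all_analysis.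
From mathcomp Require Import measurable_realfun.
From mathcomp Require mpoly.
Import (canonicals, coercions) mpoly.
From mathcomp Require Import ring lra zify.

(** Write f = P / Q with Q nonvanishing on the torus, so that there f vanishes
    exactly where P does. The map [Z_theta] is monomial, so [P (nu^a Z_theta (z))] is a Laurent polynomial in
    the m free variables z and, up to an invertible monomial, a polynomial G
    ([eval_translated_Zmap]). Both sides of the equivalence say that G is not
    the zero polynomial.

    For the integers n, write n = a + l d. Since d clears the denominators in
    the relations between the angles, the point [(e^(i theta_j n))_j] is
    [nu^a Z_theta (z)] with [z_k = e^(i theta_k l)] ([orbit_Zmap]). As a function
    of l, G at that point is a finite combination of powers [w_e ^ l], one for
    each exponent e of G, where [w_e = exp (i sum_k e_k theta_k)]. The rational
    independence of [2 pi, theta_1, .., theta_m] makes the [w_e] distinct, and a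
    Vandermonde argument shows that the combination vanishes for all l only if G
    is zero ([orbit_avoids_zeros]).

    For the probability, if G is zero then the event is certain. If not, the
    event is null by a counting argument ([zero_set_null]). The law of Z is invariant under
    rotations, so for every u on the circle and natural numbers [v_k] the event
    [G (u^v_1 Z_1, .., u^v_m Z_m) = 0] has one and the same probability p. When
    the [v_k] give distinct weights to the exponents of G, then for a fixed
    value of Z the left-hand side is a nonzero polynomial in u of degree bounded
    independently of Z. So among K such events with distinct u at most M occur
    together, hence K p <= M for every K, and p = 0. *)

Set Implicit Arguments.
Unset Strict Implicit.
Unset Printing Implicit Defensive.

Import Order.TTheory GRing.Theory Num.Theory.

Local Open Scope classical_set_scope.
Local Open Scope ring_scope.
Local Open Scope complex_scope.

(** * The exponential of an imaginary number *)

Section Cis.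
Variable R : realType.
Implicit Types t x y : R.

Lemma cisD x y : cis (x + y) = cis x * cis y.
Proof.
by rewrite /cis cosD sinD; apply/eqP; rewrite eq_complex/= eqxx/= addrC.
Qed.

Lemma cis0 : cis (0 : R) = 1.
Proof. by rewrite /cis cos0 sin0. Qed.

Lemma norm_cis x : `|cis x| = 1.
Proof. by rewrite normc_def /= cos2Dsin2 sqrtr1. Qed.

Lemma cis_neq0 x : cis x != 0.
Proof. by rewrite -normr_eq0 norm_cis oner_eq0. Qed.

Lemma cisN x : cis (- x) = (cis x)^-1.
Proof.
by apply: (mulfI (cis_neq0 x)); rewrite -cisD subrr cis0 mulfV// cis_neq0.
Qed.

Lemma cisMn x n : cis (x * n%:R) = cis x ^+ n.
Proof.
elim: n => [|n ih]; first by rewrite mulr0 cis0 expr0.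
by rewrite exprS -ih -cisD; congr cis; rewrite -natr1; ring.
Qed.

Lemma cisMz x (n : int) : cis (x * n%:~R) = cis x ^ n.
Proof.
by case: n => n; rewrite ?NegzE ?mulrNz ?mulrN ?cisN -?pmulrn cisMn ?exprnN.
Qed.

Lemma cis_sum (I : Type) (r : seq I) (F : I -> R) :
  cis (\sum_(i <- r) F i) = \prod_(i <- r) cis (F i).
Proof. by apply: (big_morph _ cisD cis0). Qed.

Lemma cis2pi : cis (2 * pi : R) = 1.
Proof. by rewrite /cis mulr_natl cos2pi sin2pi. Qed.

Lemma cis_2piz (n : int) : cis (2 * pi * n%:~R : R) = 1.
Proof. by rewrite cisMz cis2pi exp1rz. Qed.

(** With y the fractional part of x, [cos (2 pi y) = 1 - 2 sin^2 (pi y)], and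
    the sine does not vanish strictly between 0 and pi. *)
Lemma cis_eq1 x : cis (2 * pi * x) = 1 -> exists n : int, x = n%:~R.
Proof.
move=> e; exists (Num.floor x).
set y := x - (Num.floor x)%:~R.
have y0 : 0 <= y by rewrite subr_ge0 floor_le_tmp.
have y1 : y < 1 by rewrite ltrBlDl; have := floorD1_gt x; rewrite intrD1.
have : cis (2 * pi * y) = 1.
  by rewrite /y mulrBr cisD cisN cis_2piz invr1 mulr1.
move=> /(congr1 (@complex.Re R)) /= cy.
move: y0; rewrite le_eqVlt => /predU1P[y0|y0].
  by apply/eqP; rewrite -subr_eq0 -/y -y0.
have py : 0 < sin (pi * y).
  by apply: sin_gt0_pi; rewrite mulr_gt0 ?pi_gt0//= -[ltRHS]mulr1 ltr_pM2l ?pi_gt0.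
have : 2 * sin (pi * y) ^+ 2 = 0.
  have := cos_mulr2n (pi * y); rewrite -[_ *+ 2]mulr_natl mulrA cy cos2sin2.
  by rewrite -mulr_natl => h; lra.
by move/eqP; rewrite mulf_eq0 pnatr_eq0/= expf_eq0/= gt_eqF.
Qed.

End Cis.

(** * Polynomials and exponents *)

Section Weights.

Lemma nat_nonroot (K : numDomainType) (p : {poly K}) :
  p != 0 -> exists x : nat, ~~ root p x%:R.
Proof.
move=> p0; apply/not_existsP => h.
have := @max_poly_roots K p [seq n%:R | n <- iota 0 (size p)] p0.
rewrite map_inj_uniq; last by move=> i j /eqP; rewrite eqr_nat => /eqP.
rewrite iota_uniq size_map size_iota ltnn => H.
suff: false by []. apply: H => //.
by apply/allP => _ /mapP[n _ ->]; apply: contrapT => /negP; exact: h.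
Qed.

(** Weights of the form [v_k = x ^ k] do: two distinct exponents get the same
    weight only if x is a root of the polynomial whose coefficients are their
    differences, and the product of these polynomials is nonzero. *)
Lemma separating_weight m (S : seq (mpoly.multinom m)) :
  exists v : 'I_m -> nat,
    {in S &, injective (fun e : mpoly.multinom m => \sum_k e k * v k)%N}.
Proof.
pose D (e e' : mpoly.multinom m) : {poly int} :=
  \sum_(k < m) ((e k)%:Z - (e' k)%:Z) *: 'X^k.
have D0 e e' : D e e' = 0 -> e = e'.
  move=> De; apply/mpoly.mnmP => k; have /(congr1 (fun p : {poly int} => p`_k)) := De.
  rewrite coef_sum coef0 (bigD1 k)//= big1 ?addr0.
    by rewrite coefZ coefXn eqxx mulr1 => /eqP; rewrite subr_eq0 eqz_nat => /eqP.
  by move=> j jk; rewrite coefZ coefXn eq_sym val_eqE (negPf jk) mulr0.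
pose p := \prod_(x <- [seq (e, e') | e <- S, e' <- S] | x.1 != x.2) D x.1 x.2.
have : p != 0.
  rewrite prodf_seq_neq0; apply/allP => -[e e'] _ /=; apply/implyP.
  by apply: contraNneq => /D0 ->.
move=> /nat_nonroot[x px]; exists (fun k => x ^ k)%N => e e' eS e'S eq_w.
apply/eqP; apply: contraNT px => ee'; rewrite rootE horner_prod.
rewrite (big_rem (e, e')) /=; last by apply/allpairsP; exists (e, e').
rewrite ee'; suff -> : (D e e').[x%:R] = 0 by rewrite mul0r.
have wE (h : mpoly.multinom m) :
    ((\sum_k h k * x ^ k)%N : int) = \sum_k (h k)%:Z * x%:Z ^+ k.
  rewrite -natz natr_sum; apply: eq_bigr => k _.
  by rewrite natrM natrX !natz.
apply/eqP; rewrite horner_sum natz.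
under eq_bigr do rewrite hornerZ hornerXn mulrBl.
by rewrite sumrB subr_eq0 -!wE eq_w.
Qed.

End Weights.

Section Laurent.
Variables (K : fieldType) (m : nat).

(** Negative exponents are bounded below over the finite set of terms, so a
    common monomial clears them. *)
Lemma clear_denominators (T : eqType) (r : seq T) (c : T -> K)
    (ex : T -> 'I_m -> int) :
  exists (N : nat) (G : mpoly.mpoly m K), forall z : 'I_m -> K,
    (forall k, z k != 0) ->
    mpoly.meval z G =
    (\prod_k z k ^+ N) * \sum_(x <- r) c x * \prod_k z k ^ ex x k.
Proof.
pose N := (\sum_(x <- r) \sum_k `|ex x k|)%N.
have exN x k : x \in r -> 0 <= N%:Z + ex x k.
  move=> xr; suff : (`|ex x k| <= N)%N by lia.
  rewrite /N (big_rem x)//= (bigD1 k)//= -addnA; exact: leq_addr.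
exists N, (\sum_(x <- r) c x *:
  mpoly.mpolyX K (mpoly.Multinom [tuple absz (N%:Z + ex x k)%R | k < m])) => z z0.
rewrite raddf_sum mulr_sumr big_seq [RHS]big_seq; apply: eq_bigr => x xr /=.
rewrite mpoly.mevalZ mpoly.mevalX mulrCA -big_split/=; congr (_ * _).
apply: eq_bigr => k _; rewrite mpoly.mnmE !exprnP -expfzDr//.
by rewrite gez0_abs// exN.
Qed.

(** Vandermonde: the hypothesis says that the sum of the [g x * p.[w x]]
    vanishes for every polynomial p, in particular for one that vanishes at
    all nodes but one. *)
Lemma powers_independent (T : eqType) (r : seq T) (g w : T -> K) :
  uniq r -> {in r &, injective w} ->
  (forall l : nat, \sum_(x <- r) g x * w x ^+ l = 0) ->
  forall x, x \in r -> g x = 0.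
Proof.
move=> ur iw h x xr.
have hp (p : {poly K}) : \sum_(y <- r) g y * p.[w y] = 0.
  under eq_bigr do rewrite horner_coef mulr_sumr.
  rewrite exchange_big big1// => i _.
  under eq_bigr do rewrite mulrCA.
  by rewrite -mulr_sumr h mulr0.
pose p := \prod_(y <- rem x r) ('X - (w y)%:P).
have := hp p; rewrite (big_rem x)//= big_seq big1 ?addr0; last first.
  move=> y yr; rewrite horner_prod (big_rem y)//= hornerXsubC subrr mul0r.
  by rewrite mulr0.
move/eqP; rewrite mulf_eq0 => /orP[/eqP//|]; rewrite horner_prod prodf_seq_eq0.
move=> /hasP[y yr /=]; rewrite hornerXsubC subr_eq0 => /eqP /iw xy.
by move: (yr); rewrite -(xy xr (mem_rem yr)) mem_rem_uniqF.
Qed.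

End Laurent.

(** * Values along the orbit of the angles *)

Section Orbit.
Variable R : realType.

(** A finite exponential sum in l determines its coefficients as soon as its
    frequencies are distinct modulo 2 pi; so no equidistribution is needed. *)
Lemma orbit_avoids_zeros m (t : 'I_m -> R) (G : mpoly.mpoly m R[i]) :
  (forall (n : int) (e : 'I_m -> int),
    \sum_k (e k)%:~R * t k = 2 * pi * n%:~R -> forall k, e k = 0) ->
  G != 0 ->
  exists l : nat, mpoly.meval (fun k => cis (t k * l%:R)) G != 0.
Proof.
move=> tfree G0; apply/not_existsP => h.
pose phase (e : mpoly.multinom m) := \sum_k (e k)%:R * t k.
suff msupp0 e : e \in mpoly.msupp G -> mpoly.mcoeff e G = 0.
  case/eqP: G0; apply/mpoly.mpolyP => e; rewrite mpoly.mcoeff0.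
  by have [/msupp0//|/mpoly.memN_msupp_eq0] := boolP (e \in mpoly.msupp G).
apply: (@powers_independent _ _ _ (fun e => mpoly.mcoeff e G)
  (fun e => cis (phase e))) e; first exact: mpoly.msupp_uniq.
- move=> e e' _ _ /eqP ee'; apply/mpoly.mnmP => k.
  have : cis (2 * pi * ((phase e - phase e') / (2 * pi))) = 1.
    rewrite mulrC divfK ?mulf_neq0 ?pnatr_eq0 ?gt_eqF ?pi_gt0//.
    by rewrite cisD cisN (eqP ee') divff// cis_neq0.
  move=> /cis_eq1[n en].
  have := tfree n (fun k => (e k)%:Z - (e' k)%:Z); rewrite -en mulrC.
  rewrite divfK ?mulf_neq0 ?pnatr_eq0 ?gt_eqF ?pi_gt0// => /(_ _ k) H.
  suff : (e k)%:Z - (e' k)%:Z = 0 by lia.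
  apply: H; rewrite /phase -sumrB; apply: eq_bigr => j _.
  by rewrite intrB mulrBl.
- move=> l; have /negP/negPn/eqP := h l; rewrite mpoly.mevalE => hl.
  rewrite -[RHS]hl; apply: eq_bigr => e _; congr (_ * _); rewrite -cisMn mulr_suml cis_sum.
  apply: eq_bigr => k _; rewrite -cisMn; congr cis; ring.
Qed.

(** Integer relations are rational ones; this turns freeness of a list into the
    hypothesis of [orbit_avoids_zeros]. *)
Lemma Qfree_int m (u : R) (t : 'I_m -> R) (n : int) (e : 'I_m -> int) :
  Qfree (u :: [seq t k | k <- enum 'I_m]) ->
  \sum_k (e k)%:~R * t k = u * n%:~R -> forall k, e k = 0.
Proof.
move=> free eq_sum k.
pose s := u :: [seq t k | k <- enum 'I_m].
pose q : seq rat := (- n)%:~R :: [seq (e k)%:~R | k <- enum 'I_m].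
have sizes : size [seq t k | k <- enum 'I_m] = m by rewrite size_map size_enum_ord.
have nthE (T : Type) (x0 : T) (F : 'I_m -> T) (j : 'I_m) :
    nth x0 [seq F i | i <- enum 'I_m] j = F j.
  by rewrite (nth_map k) ?size_enum_ord// nth_ord_enum.
have km : (k.+1 < size s)%N by rewrite /s /= sizes ltnS.
have := free (fun i => q`_i); move=> /(_ _ (Ordinal km)) H.
suff : q`_k.+1 = 0.
  by rewrite /= nthE => /eqP; rewrite intr_eq0 => /eqP.
apply: H.
transitivity (\sum_(0 <= i < size s) ratr q`_i * s`_i); first by rewrite big_mkord.
rewrite /s /= sizes big_nat_recl//= ratr_int big_mkord.
rewrite (eq_bigr (fun j => (e j)%:~R * t j)) ?eq_sum => [|j _].
  by rewrite intrN; ring.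
by rewrite !nthE ratr_int.
Qed.

End Orbit.

(** * The monomial map of Z_theta *)

Section Substitution.
Variables (R : realType) (m s : nat) (c : 'I_s -> rat) (b : 'I_m -> 'I_s -> rat).
Local Notation d := (common_denom c b).
Local Notation h := (expo c b).

(** The monomial map underlying [Ztheta], as a function of a point of the
    m-dimensional torus. *)
Definition Zmap (z : 'I_m -> R[i]) : 'I_(m + s) -> R[i] :=
  Ztheta c b (fun k (_ : unit) => z k) tt.

Lemma norm_Zmap z : torus z -> torus (Zmap z).
Proof.
move=> z1 i; rewrite /circle/= /Zmap /Ztheta; case: (fintype.split i) => k.
  by rewrite normrX z1 expr1n.
rewrite normr_prod big1// => j _.
by case: (h j k) => n; rewrite ?NegzE -?exprnN ?normfV normrX z1 expr1n ?invr1.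
Qed.

Lemma monomial_Zmap (z : 'I_m -> R[i]) (alpha : 'I_(m + s) -> nat) :
  (forall k, z k != 0) ->
  \prod_i Zmap z i ^+ alpha i =
  \prod_k z k ^ ((d * alpha (lshift s k))%:Z +
                 \sum_j h k j * (alpha (rshift m j))%:Z).
Proof.
move=> z0; rewrite big_split_ord /=.
under [X in X * _]eq_bigr => k _.
  rewrite /Zmap /Ztheta; case: split_ordP => [k' /lshift_inj <-|j /eqP]; last first.
    by rewrite eq_lrshift.
  over.
under [X in _ * X]eq_bigr => j _.
  rewrite /Zmap /Ztheta; case: split_ordP => [k /eqP|j' /rshift_inj <-].
    by rewrite eq_rlshift.
  rewrite -prodrXl. over.
rewrite exchange_big -big_split /=; apply: eq_bigr => k _.
rewrite expfzDr// -exprM; congr (_ * _).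
rewrite (big_morph (fun n : int => z k ^ n) (id1 := 1) (op1 := *%R))//.
  by apply: eq_bigr => j _; rewrite exprnP exprz_exp.
by move=> x y; rewrite expfzDr.
Qed.

(** Composing a polynomial with a translate of [Zmap] gives a Laurent
    polynomial on the torus, which a monomial turns into a polynomial. *)
Lemma eval_translated_Zmap (y : 'I_(m + s) -> R[i]) (P : mpoly.mpoly (m + s) R[i]) :
  exists G : mpoly.mpoly m R[i], forall z : 'I_m -> R[i],
    (forall k, z k != 0) ->
    (mpoly.meval (fun i => y i * Zmap z i) P == 0) = (mpoly.meval z G == 0).
Proof.
pose cf (al : mpoly.multinom (m + s)) := mpoly.mcoeff al P * \prod_i y i ^+ al i.
pose ex (al : mpoly.multinom (m + s)) k : int := (d * al (lshift s k))%:Z +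
                 \sum_j h k j * (al (rshift m j))%:Z.
have [N [G GE]] := clear_denominators (mpoly.msupp P) cf ex.
exists G => z z0.
have zN0 : \prod_k z k ^+ N != 0 by apply/prodf_neq0 => k _; exact: expf_neq0.
rewrite GE// mulf_eq0 (negPf zN0) /=.
rewrite mpoly.mevalE; congr (_ == _); apply: eq_bigr => al _.
rewrite /cf -mulrA; congr (_ * _); rewrite -monomial_Zmap// -big_split/=.
by apply: eq_bigr => i _; rewrite exprMn.
Qed.

(** Along the arithmetic progression of step d the orbit of [theta] stays in a
    single translate of the image of [Zmap], because the [d * c j] are
    integers. *)
Lemma orbit_Zmap (theta : 'I_(m + s) -> R) (a : nat) (l : int) i :
  (forall j : 'I_s, theta (rshift m j) =
     2 * pi * ratr (c j) + \sum_(k < m) ratr (b k j) * theta (lshift s k)) ->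
  cis (theta i * (a%:Z + l * d%:Z)%:~R) =
  cis (theta i) ^+ a * Zmap (fun k => cis (theta (lshift s k) * l%:~R)) i.
Proof.
move=> thetaE; rewrite intrD mulrDr cisD -pmulrn cisMn; congr (_ * _).
rewrite intrM -pmulrn mulrA cisMn /Zmap /Ztheta.
case: split_ordP => [k ->//|j ->].
have dc : exists n : int, d%:R * c j = n%:~R.
  have /dvdnP[q e] : (`|denq (c j)| %| d)%N.
    apply: dvdn_trans (dvdn_lcml _ _).
    rewrite (bigD1 j)//=; exact: dvdn_lcml.
  exists (q%:Z * numq (c j)).
  by rewrite e natrM intrM numqE -{2}absz_denq -mulrA; ring.
have [n en] := dc.
rewrite -cisMn thetaE.
rewrite (_ : _ * _ * _ = 2 * pi * (l * n)%:~R +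
  \sum_(k < m) theta (lshift s k) * l%:~R * (h k j)%:~R).
  by rewrite cisD cis_2piz mul1r cis_sum; apply: eq_bigr => k _; rewrite cisMz.
have ratE (x : rat) (p : int) : d%:R * x = p%:~R -> d%:R * ratr x = p%:~R :> R.
  by move=> /(congr1 (@ratr R)); rewrite rmorphM/= ratr_nat ratr_int.
rewrite mulrDl mulrDl mulr_suml mulr_suml; congr (_ + _).
  by rewrite intrM -(ratE _ _ en); ring.
apply: eq_bigr => k _; rewrite -(ratE _ _ (esym (expoE c b k j))); ring.
Qed.

End Substitution.

(** * Measurability of complex-valued functions *)

(** A base point of the plane, so that a sigma-algebra can be put on the
    families of complex numbers. *)
HB.instance Definition _ (R : realType) := isPointed.Build R[i] 0.

Section ComplexMeasurability.
Context (R : realType) (disp : measure_display) (T : measurableType disp).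
Implicit Types F G : T -> R[i].

Definition cmeasurable_fun F :=
  measurable_fun setT (fun w => complex.Re (F w)) /\
  measurable_fun setT (fun w => complex.Im (F w)).

Lemma cmeasurable_cst (z : R[i]) : cmeasurable_fun (fun=> z).
Proof. by split; exact: measurable_cst. Qed.

Lemma cmeasurableD F G : cmeasurable_fun F -> cmeasurable_fun G ->
  cmeasurable_fun (fun w => F w + G w).
Proof.
have RD (x y : R[i]) : complex.Re (x + y) = complex.Re x + complex.Re y.
  by case: x y => [? ?] [].
have ID (x y : R[i]) : complex.Im (x + y) = complex.Im x + complex.Im y.
  by case: x y => [? ?] [].
move=> [Fr Fi] [Gr Gi]; split.
  by under eq_fun do rewrite RD; exact: measurable_funD.
by under eq_fun do rewrite ID; exact: measurable_funD.
Qed.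

Lemma cmeasurableM F G : cmeasurable_fun F -> cmeasurable_fun G ->
  cmeasurable_fun (fun w => F w * G w).
Proof.
have RM (x y : R[i]) : complex.Re (x * y) =
    complex.Re x * complex.Re y - complex.Im x * complex.Im y.
  by case: x y => [? ?] [].
have IM (x y : R[i]) : complex.Im (x * y) =
    complex.Re x * complex.Im y + complex.Im x * complex.Re y.
  by case: x y => [? ?] [].
move=> [Fr Fi] [Gr Gi]; split.
  by under eq_fun do rewrite RM; apply: measurable_funB; exact: measurable_funM.
by under eq_fun do rewrite IM; apply: measurable_funD; exact: measurable_funM.
Qed.

Lemma cmeasurable_sum (I : Type) (r : seq I) (F : I -> T -> R[i]) :
  (forall i, cmeasurable_fun (F i)) ->
  cmeasurable_fun (fun w => \sum_(i <- r) F i w).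
Proof.
move=> mF; elim: r => [|i r ih].
  by under eq_fun do rewrite big_nil; exact: cmeasurable_cst.
by under eq_fun do rewrite big_cons; exact: cmeasurableD.
Qed.

Lemma cmeasurable_prod (I : Type) (r : seq I) (F : I -> T -> R[i]) :
  (forall i, cmeasurable_fun (F i)) ->
  cmeasurable_fun (fun w => \prod_(i <- r) F i w).
Proof.
move=> mF; elim: r => [|i r ih].
  by under eq_fun do rewrite big_nil; exact: cmeasurable_cst.
by under eq_fun do rewrite big_cons; exact: cmeasurableM.
Qed.

Lemma cmeasurableX F n : cmeasurable_fun F -> cmeasurable_fun (fun w => F w ^+ n).
Proof.
move=> mF; elim: n => [|n ih].
  by under eq_fun do rewrite expr0; exact: cmeasurable_cst.
by under eq_fun do rewrite exprS; exact: cmeasurableM.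
Qed.

Lemma cmeasurable_meval m (Z : 'I_m -> T -> R[i]) (G : mpoly.mpoly m R[i]) :
  (forall k, cmeasurable_fun (Z k)) ->
  cmeasurable_fun (fun w => mpoly.meval (fun k => Z k w) G).
Proof.
move=> mZ; under eq_fun do rewrite mpoly.mevalE.
apply: cmeasurable_sum => e; apply: cmeasurableM; first exact: cmeasurable_cst.
by apply: cmeasurable_prod => k; exact: cmeasurableX.
Qed.

Lemma cmeasurable_preimage F (A : set R[i]) :
  cmeasurable_fun F -> Cmeasurable A -> measurable (F @^-1` A).
Proof.
move=> [Fr Fi] mA; have := measurable_fun_pair Fr Fi measurableT mA.
rewrite setTI (_ : _ @^-1` _ = F @^-1` A)//.
by apply/seteqP; split => w /=; case: (F w).
Qed.

Lemma Cmeasurable0 : Cmeasurable [set (0 : R[i])].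
Proof.
rewrite /Cmeasurable (_ : [set _ | _] = [set 0 : R] `*` [set 0 : R]).
  exact: measurableX.
by apply/seteqP; split => -[x y] /=; [case=> -> ->|case=> /= -> ->].
Qed.

End ComplexMeasurability.

Lemma cmeasurable_circle_rv (R : realType) (disp : measure_display)
    (Om : measurableType disp) (Z : Om -> R[i]) :
  circle_rv Z -> cmeasurable_fun Z.
Proof.
move=> [_ mZ]; split=> _ B mB; rewrite setTI.
  apply: (mZ [set z | B (complex.Re z)]); rewrite /Cmeasurable /=.
  by rewrite -[X in measurable X]setTI; exact: measurable_fst.
apply: (mZ [set z | B (complex.Im z)]); rewrite /Cmeasurable /=.
by rewrite -[X in measurable X]setTI; exact: measurable_snd.
Qed.

Lemma Cmeasurable_mul (R : realType) (y : R[i]) (A : set R[i]) :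
  Cmeasurable A -> Cmeasurable [set z | A (y * z)].
Proof.
move=> mA; rewrite /Cmeasurable /=.
apply: (@cmeasurable_preimage R _ (R * R)%type (fun p => y * (p.1 +i* p.2))) => //.
apply: cmeasurableM; first exact: cmeasurable_cst.
by split; [exact: measurable_fst|exact: measurable_snd].
Qed.

(** * Rotation invariance of the uniform law *)

Section Rotation.
Variable R : realType.
Local Notation mu := (@lebesgue_measure R).

Lemma measurable_shift (tau : R) (A : set R) :
  measurable A -> measurable [set x | A (x + tau)].
Proof.
move=> mA; rewrite -[X in measurable X]setTI.
by apply: (measurable_funD _ (measurable_cst _)) => //; exact: measurable_id.
Qed.

Lemma lebesgue_measure_shift (tau : R) (A : set R) :
  measurable A -> mu [set x | A (x + tau)] = mu A.
Proof.
move=> mA; pose sh : R -> measurableTypeR R := fun x => x + tau.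
have msh : measurable_fun setT sh.
  by move=> _ B mB; rewrite setTI; exact: measurable_shift.
rewrite -[LHS]/(pushforward mu sh A).
apply/esym/lebesgue_measure_unique => //= _ [[x y]] _ <-.
rewrite /pushforward (_ : sh @^-1` _ = `]x - tau, y - tau]%classic); last first.
  by apply/seteqP; split => z /=; rewrite !in_itv/= ltrBlDr lerBrDr.
by rewrite !lebesgue_measure_itv/= !lte_fin ltrD2r -!EFinB; case: ifP => // _; congr EFin; ring.
Qed.

Lemma uniform_prob01E (A : set R) : measurable A ->
  uniform_prob (@ltr01 R) A = mu (A `&` `]0, 1]).
Proof.
move=> mA; rewrite /uniform_prob integral_uniform_pdf.
rewrite (eq_integral (cst 1%E)); last first.
  move=> x; rewrite inE => -[_]; rewrite /= in_itv/= /uniform_pdf => ->.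
  by rewrite subr0 invr1.
rewrite integral_cst ?mul1e; last exact: measurableI.
rewrite (_ : _ `&` `[0, 1] = (A `&` `]0, 1]) `|` (A `&` [set 0])); last first.
  rewrite -setIUr -(@setU1itv _ R (BRight 1) 0 false) ?bnd_simp//; first by rewrite setUC.
by rewrite measureU0//; [exact: measurableI|exact: measurableI|
  apply: (subset_measure0 _ _ _ (lebesgue_measure_set1 (0 : R))) => //; exact: measurableI].
Qed.

(** Shifting by tau moves the window to [`]tau, 1 + tau]]; periodicity brings
    its part beyond 1 back to [`]0, tau]]. *)
Lemma measure_period (tau : R) (B : set R) : 0 <= tau <= 1 -> measurable B ->
  (forall x, B (x + 1) <-> B x) ->
  mu ([set x | B (x + tau)] `&` `]0, 1]) = mu (B `&` `]0, 1]).
Proof.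
move=> /andP[t0 t1] mB perB.
have mI (x y : R) : measurable (B `&` `]x, y]) by exact: measurableI.
have -> : [set x | B (x + tau)] `&` `]0, 1] =
    [set x | (B `&` `]tau, 1 + tau]) (x + tau)].
  by apply/seteqP; split => x /= [Bx]; rewrite !in_itv/= lerD2r ltrDr.
rewrite lebesgue_measure_shift//.
have split_itv (x y z : R) : x <= y -> y <= z ->
    mu (B `&` `]x, z]) = (mu (B `&` `]x, y]) + mu (B `&` `]y, z]))%E.
  move=> xy yz; rewrite -measureU; [|exact: mI|exact: mI|].
    by rewrite -setIUr -itv_bndbnd_setU ?bnd_simp.
  by apply/seteqP; split => u //= -[[_]] /[swap] -[_]; rewrite !in_itv/=; lra.
have t2 : 1 <= 1 + tau by rewrite lerDl.
rewrite (split_itv _ _ _ t1 t2) (split_itv _ _ _ t0 t1).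
rewrite addeC; congr (_ + _)%E.
rewrite -(lebesgue_measure_shift 1 (mI 1 (1 + tau))); congr mu.
have itvE (x : R) : (x + 1 \in `]1, 1 + tau]) = (x \in `]0, tau]).
  by rewrite !in_itv/= (addrC x) ltrDl lerD2l.
by apply/seteqP; split => x /=; rewrite itvE => -[/perB].
Qed.

Lemma measurable_cis_preimage (A : set R[i]) :
  Cmeasurable A -> measurable [set t : R | A (cis (2 * pi * t))].
Proof.
move=> mA; apply: (@cmeasurable_preimage R _ R (fun t => cis (2 * pi * t))) => //.
split; apply: measurableT_comp; try exact: mulrl_measurable.
  by apply: continuous_measurable_fun; exact: continuous_cos.
by apply: continuous_measurable_fun; exact: continuous_sin.
Qed.

Lemma uniform_prob_rotation (tau : R) (A : set R[i]) : Cmeasurable A ->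
  uniform_prob (@ltr01 R) [set t | A (cis (2 * pi * tau) * cis (2 * pi * t))] =
  uniform_prob (@ltr01 R) [set t | A (cis (2 * pi * t))].
Proof.
move=> mA; pose fr := tau - (Num.floor tau)%:~R.
(* Only the fractional part of tau matters, and [measure_period] needs a shift
   between 0 and 1. *)
have fr01 : 0 <= fr <= 1.
  rewrite subr_ge0 floor_le_tmp/= lerBlDl ltW//.
  by have := floorD1_gt tau; rewrite intrD1.
have mB := measurable_cis_preimage mA.
have -> : [set t | A (cis (2 * pi * tau) * cis (2 * pi * t))] =
    [set t | A (cis (2 * pi * (t + fr)))].
  have rotE t : cis (2 * pi * (t + fr)) = cis (2 * pi * tau) * cis (2 * pi * t).
    rewrite (_ : _ * _ = 2 * pi * tau + 2 * pi * t -
      2 * pi * (Num.floor tau)%:~R); last by rewrite /fr; ring.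
    by rewrite !cisD cisN cis_2piz invr1 mulr1.
  by apply/seteqP; split => t /=; rewrite rotE.
rewrite !uniform_prob01E//; last exact: (measurable_shift fr mB).
apply: (measure_period fr01 mB) => x /=.
by rewrite mulrDr cisD mulr1 cis2pi mulr1.
Qed.

End Rotation.

Section IndependentRotation.
Context (R : realType) (disp : measure_display) (Om : measurableType disp)
  (Pr : probability Om R) (m : nat).
Variables (Z : 'I_m -> Om -> R[i]) (tau : 'I_m -> R).
Local Notation Y := (fun k w => cis (2 * pi * tau k) * Z k w).

Lemma circle_rv_rotation :
  (forall k, circle_rv (Z k)) -> forall k, circle_rv (Y k).
Proof.
move=> cZ k; split=> [w|A mA].
  by rewrite /circle /= normrM norm_cis mul1r; exact: (cZ k).1.
exact: ((cZ k).2 _ (Cmeasurable_mul (cis (2 * pi * tau k)) mA)).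
Qed.

Lemma uniform_rotation :
  (forall k, uniform_on_circle Pr (Z k)) ->
  forall k, uniform_on_circle Pr (Y k).
Proof.
move=> uZ k A mA; rewrite -(uniform_prob_rotation (tau k) mA).
exact: (uZ k _ (Cmeasurable_mul (cis (2 * pi * tau k)) mA)).
Qed.

Lemma independent_rotation : mutually_independent Pr Z -> mutually_independent Pr Y.
Proof.
move=> iZ J A mA.
exact: (iZ J (fun k => [set z | A k (cis (2 * pi * tau k) * z)])
  (fun k => Cmeasurable_mul _ (mA k))).
Qed.

End IndependentRotation.

(** * Uniqueness of the joint law *)

Section JointLaw.
Context (R : realType) (disp : measure_display) (Om : measurableType disp)
  (Pr : probability Om R) (m : nat).

Definition rectangles : set (set ('I_m -> R[i])) :=
  [set B | exists2 A : 'I_m -> set R[i],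
     forall k, Cmeasurable (A k) & B = [set z | forall k, A k (z k)]].

(** The coordinates are measurable by the choice of generators, hence so is
    every polynomial in them. *)
Lemma zero_set_measurable (G : mpoly.mpoly m R[i]) :
  <<s rectangles >> [set z | mpoly.meval z G = 0].
Proof.
pose T := g_sigma_algebraType rectangles.
have coord k : cmeasurable_fun (fun z : T => z k).
  have rect (A : set R[i]) : Cmeasurable A ->
      measurable (setT `&` [set z : T | A (z k)]).
    move=> mA; rewrite setTI; apply: sub_sigma_algebra.
    exists (fun j => if j == k then A else setT).
      by move=> j; case: eqP => // _; exact: measurableT.
    apply/seteqP; split => z /= h; first by move=> j; case: eqP => // ->.
    by have := h k; rewrite eqxx.
  split=> _ B mB.
    apply: (rect [set x | B (complex.Re x)]); rewrite /Cmeasurable /=.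
    by rewrite -[X in measurable X]setTI; exact: measurable_fst.
  apply: (rect [set x | B (complex.Im x)]); rewrite /Cmeasurable /=.
  by rewrite -[X in measurable X]setTI; exact: measurable_snd.
exact: (cmeasurable_preimage (cmeasurable_meval G coord) (@Cmeasurable0 R)).
Qed.

(** Uniqueness of product measures: rectangles are stable under intersection
    and generate, and the law of an independent family on them is determined by
    the marginals. *)
Lemma joint_law_unique (Z Y : 'I_m -> Om -> R[i]) (B : set ('I_m -> R[i])) :
  (forall k, circle_rv (Z k)) -> (forall k, circle_rv (Y k)) ->
  (forall k, uniform_on_circle Pr (Z k)) ->
  (forall k, uniform_on_circle Pr (Y k)) ->
  mutually_independent Pr Z -> mutually_independent Pr Y ->
  <<s rectangles >> B ->
  Pr [set w | B (fun k => Z k w)] = Pr [set w | B (fun k => Y k w)].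
Proof.
move=> cZ cY uZ uY iZ iY sB.
have joint_mfun (X : 'I_m -> Om -> R[i]) : (forall k, circle_rv (X k)) ->
    measurable_fun setT ((fun w k => X k w) : Om -> g_sigma_algebraType rectangles).
  move=> cX; apply: (@measurability _ _ Om (g_sigma_algebraType rectangles) setT _
    rectangles erefl) => _ [_ [A mA ->] <-].
  rewrite setTI (_ : _ @^-1` _ = \bigcap_(k in setT) (X k @^-1` A k)).
    by apply: fin_bigcap_measurable => // k _; exact: (cX k).2.
  by apply/seteqP; split => w /= h k; have := h k => // /(_ I).
have mZ := joint_mfun _ cZ; have mY := joint_mfun _ cY.
pose P (S : set (g_sigma_algebraType rectangles)) :=
  Pr [set w | S (fun k => Z k w)] = Pr [set w | S (fun k => Y k w)].
have pre (X : 'I_m -> Om -> R[i]) (S : set (g_sigma_algebraType rectangles)) :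
    measurable_fun setT ((fun w k => X k w) : Om -> g_sigma_algebraType rectangles) ->
    measurable S -> measurable [set w | S (fun k => X k w)].
  by move=> mX mS; rewrite -[X in measurable X]setTI; exact: mX.
apply: (@dynkin_induction _ (g_sigma_algebraType rectangles) rectangles P) sB => //.
- move=> _ _ [A mA ->] [A' mA' ->]; exists (fun k => A k `&` A' k).
    by move=> k; exact: (measurableI _ _ (mA k) (mA' k)).
  apply/seteqP; split => z /=; first by move=> [h h'] k.
  by move=> h; split=> k; have [] := h k.
- move=> _ [A mA ->]; rewrite /P /=.
  have rectE (X : 'I_m -> Om -> R[i]) : mutually_independent Pr X ->
      Pr [set w | forall k, A k (X k w)] = (\prod_k Pr (X k @^-1` A k))%E.
    move=> /(_ [set: 'I_m]%SET A mA) iX.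
    transitivity (\prod_(k in [set: 'I_m]%SET) Pr (X k @^-1` A k))%E; last first.
      by apply: eq_bigl => k; rewrite finset.in_setT.
    rewrite -iX; congr (Pr _); apply/seteqP; split => w /= h k; first by [].
    by apply: h; rewrite finset.in_setT.
  rewrite !rectE//; apply: eq_bigr => k _.
  by rewrite uZ// uY.
- move=> S mS PS; rewrite /P /=.
  have CE (X : 'I_m -> Om -> R[i]) :
    measurable_fun setT ((fun w k => X k w) : Om -> g_sigma_algebraType rectangles) ->
    Pr [set w | (~` S) (fun k => X k w)] = (1 - Pr [set w | S (fun k => X k w)])%E.
    by move=> mX; rewrite -probability_setC//; exact: pre.
  by rewrite !CE// PS.
- move=> F mF tF PF; rewrite /P /=.
  have UE (X : 'I_m -> Om -> R[i]) :
    measurable_fun setT ((fun w k => X k w) : Om -> g_sigma_algebraType rectangles) ->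
    Pr [set w | (\bigcup_k F k) (fun k => X k w)] =
    (\sum_(0 <= n <oo) Pr [set w | F n (fun k => X k w)])%E.
    move=> mX.
    transitivity (\sum_(0 <= n <oo | n \in [set: nat])
                   Pr [set w | F n (fun k => X k w)])%E; last first.
      by apply: eq_eseriesl => n; rewrite in_setT.
    rewrite -measure_bigcup//; first by move=> n _; exact: pre.
    apply/trivIsetP => i j _ _ ij; rewrite -subset0 => w [Fi Fj].
    move/trivIsetP : tF => /(_ i j I I ij); rewrite -subset0.
    by move=> /(_ (fun k => X k w)); apply.
  by rewrite !UE//; congr (limn _); apply/funext => n; apply: eq_bigr => k _; exact: PF.
Qed.

End JointLaw.

(** * Zero sets of polynomials are null *)

Section ZeroSets.
Context (R : realType) (disp : measure_display) (Om : measurableType disp)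
  (Pr : probability Om R).

(** Integrate the number of events among the first K that occur: the result is
    K times the common probability, and at most M. *)
Lemma bounded_overlap_null (A : nat -> set Om) (p : \bar R) (M : nat) :
  (forall i, measurable (A i)) -> (forall i, Pr (A i) = p) ->
  (forall w K, (count (fun i => w \in A i) (iota 0 K) <= M)%N) ->
  p = 0%E.
Proof.
move=> mA PA cA.
have p0 : (0 <= p)%E by rewrite -(PA 0%N).
have pfin : p \is a fin_num by rewrite -(PA 0%N) fin_num_measure.
have mI i : measurable_fun setT (fun w => (\1_(A i) w)%:E : \bar R).
  by apply/measurable_EFinP; exact: measurable_indic.
have I0 i w : setT w -> (0 <= (\1_(A i) w)%:E :> \bar R)%E by rewrite lee_fin.
have bound K : (K%:R * fine p <= M%:R).
  have : (\sum_(i <- iota 0 K) Pr (A i) <= M%:R%:E)%E.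
    under eq_bigr => i _ do rewrite -[A i]setIT -integral_indic//.
    rewrite -(ge0_integral_sum _ measurableT mI I0).
    rewrite -[leRHS]mule1 -(@probability_setT _ _ _ Pr) -integral_cst//.
    apply: ge0_le_integral => //.
    - by move=> w _; apply: sume_ge0 => i _; rewrite lee_fin.
    - by apply: emeasurable_sum.
    - move=> w _ /=; rewrite sumEFin lee_fin.
      under eq_bigr do rewrite indicE.
      rewrite -natr_sum ler_nat (leq_trans _ (cA w K))// -sum1_count.
      by rewrite [leqRHS]big_mkcond/=; apply: leq_sum => i _; case: (w \in A i).
  rewrite (eq_bigr (fun=> (fine p)%:E)) => [|i _]; last by rewrite PA fineK.
  rewrite sumEFin lee_fin big_const_seq count_predT size_iota iter_addr_0.
  by rewrite mulr_natl.
rewrite -(fineK pfin); congr EFin; apply/eqP/negPn/negP => r0.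
have r_gt0 : 0 < fine p by rewrite lt_def r0 fine_ge0.
have := archi_boundP (divr_ge0 (ler0n R M) (ltW r_gt0)).
by rewrite ltr_pdivrMr// ltNge bound.
Qed.

(** On the curve [u |-> (u ^ v_k z_k)] the monomials of G become monomials in u
    of distinct degrees, so nothing cancels. *)
Lemma restrict_to_curve m (G : mpoly.mpoly m R[i]) : G != 0 ->
  exists (v : 'I_m -> nat) (M : nat), forall z : 'I_m -> R[i],
    (forall k, z k != 0) ->
    exists q : {poly R[i]}, [/\ q != 0, (size q <= M)%N &
      forall u, mpoly.meval (fun k => u ^+ v k * z k) G = q.[u]].
Proof.
move=> G0; have [v inj_v] := separating_weight (mpoly.msupp G).
pose wt (e : mpoly.multinom m) := (\sum_k e k * v k)%N.
exists v, (\max_(e <- mpoly.msupp G) wt e).+1 => z z0.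
pose q : {poly R[i]} := \sum_(e <- mpoly.msupp G)
  (mpoly.mcoeff e G * \prod_k z k ^+ e k) *: 'X^(wt e).
exists q; split.
- have /hasP[e eG _] : has predT (mpoly.msupp G).
    by rewrite has_predT lt0n size_eq0 mpoly.msupp_eq0.
  have ze0 : \prod_k z k ^+ e k != 0.
    by apply/prodf_neq0 => k _; rewrite expf_neq0.
  apply/eqP => /(congr1 (fun q : {poly R[i]} => q`_(wt e))) /eqP.
  rewrite coef0 coef_sum (big_rem e)//= coefZ coefXn eqxx mulr1.
  rewrite [X in _ + X]big_seq [X in _ + X]big1 => [|e'].
    rewrite addr0 mulf_eq0 (negPf ze0) orbF; apply/negP.
    by rewrite -mpoly.mcoeff_msupp.
  rewrite mem_rem_uniq ?mpoly.msupp_uniq// inE => /andP[ee' e'G].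
  rewrite coefZ coefXn; case: eqP => [/inj_v ww|_]; last by rewrite mulr0.
  by rewrite -ww ?eqxx// in ee'.
- apply: (leq_trans (size_sum _ _ _)); apply/bigmax_leqP_seq => e eG _.
  rewrite (leq_trans (size_scale_leq _ _))// size_polyXn ltnS.
  exact: (@leq_bigmax_seq _ _ predT wt).
- move=> u; rewrite mpoly.mevalE horner_sum; apply: eq_bigr => e _.
  rewrite hornerZ hornerXn -mulrA; congr (_ * _).
  rewrite /wt -prodrXr mulrC -big_split /=; apply: eq_bigr => k _.
  by rewrite exprMn -exprM mulnC.
Qed.

(** By rotation invariance the zero set has the same probability as each of its
    rotates by [(u ^ v_k)], u on the circle; by the previous lemma a point lies
    in a bounded number of these. *)
Lemma zero_set_null m (Z : 'I_m -> Om -> R[i]) (G : mpoly.mpoly m R[i]) :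
  (forall k, circle_rv (Z k)) -> (forall k, uniform_on_circle Pr (Z k)) ->
  mutually_independent Pr Z -> G != 0 ->
  Pr [set w | mpoly.meval (fun k => Z k w) G = 0] = 0%E.
Proof.
move=> cZ uZ iZ G0; have [v [M curve]] := restrict_to_curve G0.
(* All these parameters lie in [`]0, 1]], on which t |-> cis (2 pi t) is
   injective. *)
pose t (i : nat) : R := i.+1%:R^-1.
pose u i := cis (2 * pi * t i).
have inj_u : injective u.
  move=> i j uij.
  have : cis (2 * pi * (t i - t j)) = 1.
    by rewrite mulrBr cisD cisN -/(u i) uij divff// cis_neq0.
  move=> /cis_eq1[n tn].
  have t01 k : 0 < t k <= 1.
    by rewrite invr_gt0 ltr0Sn /= invf_le1 ?ltr0Sn// ler1n.
  have n0 : n = 0.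
    have /andP[ti0 ti1] := t01 i; have /andP[tj0 tj1] := t01 j.
    have : `|n%:~R| < 1 :> R by rewrite -tn ltr_norml; lra.
    by rewrite -intr_norm ltrz1; lia.
  by move/eqP: tn; rewrite n0 subr_eq0 => /eqP /invr_inj /eqP; rewrite eqr_nat => /eqP[].
pose A i := [set w | mpoly.meval (fun k => u i ^+ v k * Z k w) G = 0].
have AE i : A i =
    [set w | mpoly.meval (fun k => cis (2 * pi * (t i * (v k)%:R)) * Z k w) G = 0].
  by apply/seteqP; split => w /=; under mpoly.meval_eq => k do rewrite mulrA cisMn.
apply: (@bounded_overlap_null A _ M) => [i|i|w K].
- apply: (cmeasurable_preimage _ (@Cmeasurable0 R)).
  apply: cmeasurable_meval => k; apply: cmeasurableM; first exact: cmeasurable_cst.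
  exact: cmeasurable_circle_rv.
- rewrite AE; apply/esym.
  apply: (@joint_law_unique _ _ _ Pr m Z
    (fun k w => cis (2 * pi * (t i * (v k)%:R)) * Z k w) [set z | mpoly.meval z G = 0]) => //.
  + exact: circle_rv_rotation.
  + exact: uniform_rotation.
  + exact: independent_rotation.
  + exact: zero_set_measurable.
- have [|q [q0 qM qE]] := curve (fun k => Z k w).
    by move=> k; rewrite -normr_eq0 ((cZ k).1 w) oner_eq0.
  rewrite -size_filter -(size_map u); apply: leq_trans qM; apply: ltnW.
  apply: max_poly_roots => //; last first.
    by rewrite map_inj_uniq// filter_uniq// iota_uniq.
  apply/allP => _ /mapP[i + ->]; rewrite mem_filter => /andP[+ _].
  by rewrite inE /A /= qE => /eqP.
Qed.

End ZeroSets.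

(** * The dichotomy *)

(* r = m + s; the indices lshift s k and rshift m j stand for 1..m and m+1..r *)
Theorem lemma2p5 (R : realType) (m s : nat) (theta : 'I_(m + s) -> R)
    (c : 'I_s -> rat) (b : 'I_m -> 'I_s -> rat)
    (disp : measure_display) (Om : measurableType disp) (Pr : probability Om R)
    (Z : 'I_m -> Om -> R[i]) (f : ratfun R[i] (m + s)) (a : nat) :
  ~ (forall i, exists q : rat, theta i = ratr q * pi) ->
  Qbasis (2 * pi :: [seq theta (lshift s k) | k <- enum 'I_m])
         (Qspan (pi :: [seq theta i | i <- enum 'I_(m + s)])) ->
  (forall j : 'I_s, theta (rshift m j) =
     2 * pi * ratr (c j) + \sum_(k < m) ratr (b k j) * theta (lshift s k)) ->
  (forall k, circle_rv (Z k)) ->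
  (forall k, uniform_on_circle Pr (Z k)) ->
  mutually_independent Pr Z ->
  no_pole_on (@torus R (m + s)) f ->
  (a <= (common_denom c b).-1)%N ->
  Pr [set w | rat_eval f (fun i => cis (theta i) ^+ a * Ztheta c b Z w i) = 0]
    = 0%E
  <->
  exists n : int, (n = a%:Z %[mod (common_denom c b)%:Z])%Z /\
    rat_eval f (fun i => cis (theta i * n%:~R)) != 0.
Proof.
move=> _ [free _] thetaE cZ uZ iZ [P [Q [fE Q0]]] _.
set d := common_denom c b.
have cis_torus n (t : 'I_n -> R) : torus (fun i => cis (t i)).
  by move=> i; exact: norm_cis.
have torus_neq0 n (z : 'I_n -> R[i]) : torus z -> forall k, z k != 0.
  by move=> z1 k; rewrite -normr_eq0 z1 oner_eq0.
pose y i := cis (theta i) ^+ a.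
have y_torus z : torus z -> torus (fun i => y i * Zmap c b z i).
  move=> /norm_Zmap h i; rewrite /circle /= normrM normrX norm_cis expr1n mul1r.
  exact: h.
have [G GE] := eval_translated_Zmap c b y P.
have evalE z : torus z ->
    (rat_eval f (fun i => y i * Zmap c b z i) == 0) = (mpoly.meval z G == 0).
  move=> z1; rewrite fE rat_evalE ?Q0//; last exact: y_torus.
  rewrite mulf_eq0 invr_eq0 (negPf (Q0 _ (y_torus _ z1))) orbF.
  by rewrite GE//; exact: torus_neq0.
have orbitE (l : int) :
    (rat_eval f (fun i => cis (theta i * (a%:Z + l * d%:Z)%:~R)) == 0) =
    (mpoly.meval (fun k => cis (theta (lshift s k) * l%:~R)) G == 0).
  rewrite -evalE//; congr (rat_eval f _ == 0); apply/funext => i.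
  exact: orbit_Zmap.
have -> : [set w | rat_eval f (fun i => cis (theta i) ^+ a * Ztheta c b Z w i) = 0] =
    [set w | mpoly.meval (fun k => Z k w) G = 0].
  have Z1 w : torus (fun k => Z k w) by move=> k; exact: (cZ k).1.
  by apply/seteqP; split => w /= /eqP; [rewrite (evalE _ (Z1 w))|rewrite -(evalE _ (Z1 w))] => /eqP.
split=> [PG0|[n [na fn]]].
- have G0 : G != 0.
    apply/eqP => G0; move/eqP: PG0; rewrite G0.
    under eq_fun do rewrite mpoly.meval0.
    rewrite (_ : [set _ | _] = setT) ?probability_setT ?onee_eq0//.
    by apply/seteqP; split.
  have [l Gl] := orbit_avoids_zeros (fun n e => Qfree_int free) G0.
  exists (a%:Z + l%:Z * d%:Z); split; first by rewrite addrC modzMDl.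
  by rewrite orbitE.
- apply: zero_set_null => //; apply: contraNneq fn => G0.
  have /dvdzP[l el] : (d %| n - a%:Z)%Z by rewrite -eqz_mod_dvd na.
  have -> : n = a%:Z + l * d%:Z by rewrite -el; ring.
  by rewrite orbitE G0 mpoly.meval0.
Qed.
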